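(* Let $k\ge 1$ and $r$ be integers with $1\le r\le 2^k-1$, and let $\rho_1$ be the position of the smallest nonzero bit in the binary expansion of $r$ (positions numbered from $0$ at the least significant bit). Then $$\tau\left(\frac{r}{2^k}\right)=\frac{1}{2}\left(\tau\left(\frac{r-1}{2^k}\right)+\tau\left(\frac{r+1}{2^k}\right)\right)+\frac{1-\rho_1}{2^k}.$$
   Context: $\tau$ denotes the Takagi function on $[0,1]$, a continuous function. On dyadic rationals it is given as follows: for integers $k\ge 0$ and $0\le N<2^{k+1}$ with binary digits $N=\sum_{i=0}^{k}N_i2^i$, $N_i\in\{0,1\}$, and $N_i=0$ for every negative integer $i$, $\tau\left(\frac{N}{2^{k+1}}\right)=\sum_{i=1}^\infty \frac{\ell_i(N)}{2^i}$, where for $i\ge 0$, $\ell_{i+1}(N)=\sum_{j=0}^{i-1}N_{k-j}$ if $N_{k-i}=0$, and $\ell_{i+1}(N)=i-\sum_{j=0}^{i-1}N_{k-j}$ if $N_{k-i}=1$. Also $\tau(1)=0$. (Equivalently, $\tau(x)=\sum_{m=0}^\infty 2^{-m}\,\mathrm{dist}(2^m x,\mathbb{Z})$ for $x\in[0,1]$.) *)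

(* Defs.v *)
From mathcomp Require Import all_boot all_order all_algebra.
From mathcomp Require Import all_classical all_reals all_analysis.
From mathcomp Require Import lra.

Set Implicit Arguments.
Unset Strict Implicit.
Unset Printing Implicit Defensive.

Import Order.TTheory GRing.Theory Num.Theory.
Import numFieldNormedType.Exports.

Local Open Scope classical_set_scope.
Local Open Scope ring_scope.

Definition nbit (N i : nat) : bool := odd (N %/ 2 ^ i)%N.

Definition lowest_set_bit (N i : nat) : Prop :=
  nbit N i /\ forall j : nat, (j < i)%N -> ~~ nbit N j.

(* The digit of weight 2^-(n+1) in the fractional part of x >= 0; at dyadic x
   this is the expansion ending in zeros. *)
Definition frac_bit (R : realType) (x : R) (n : nat) : bool :=
  odd (Num.truncn (2 ^+ n.+1 * x)).

(* [ell a i] is \ell_{i+1} for the digit sequence [a]: the number of digits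
   before position i that differ from [a i].  The truncated subtraction is
   exact, since the sum of i digits is at most i. *)
Definition ell (a : nat -> bool) (i : nat) : nat :=
  if a i then (i - \sum_(j < i) a j)%N else (\sum_(j < i) a j)%N.

Definition ell_series (R : realType) (a : nat -> bool) : R ^nat :=
  series (fun i : nat => (ell a i)%:R / 2 ^+ i.+1).

(* Takagi's digit formula, read with real digits: a definition on all of [0, 1],
   where it is equal to the sum over m of 2^-m dist(2^m x, Z).  At dyadic x it
   is the formula in the binary digits of the numerator (takagi_dyadic).
   Values outside [0, 1] carry no meaning. *)
Definition takagi (R : realType) (x : R) : R :=
  limn (ell_series R (frac_bit x)).

Lemma ell_le (a : nat -> bool) (i : nat) : (ell a i <= i)%N.
Proof.
have le_sum : (\sum_(j < i) a j <= i)%N.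
  rewrite -[leqRHS]card_ord -sum1_card; apply: leq_sum => j _.
  by case: (a j).
by rewrite /ell; case: (a i) => //; exact: leq_subr.
Qed.

Lemma is_cvg_ell_series (R : realType) (a : nat -> bool) :
  cvgn (ell_series R a).
Proof.
apply: nondecreasing_is_cvgn.
  apply/nondecreasing_seqP => n.
  rewrite /ell_series seriesSr lerDl.
  by rewrite divr_ge0 ?ler0n ?exprn_ge0.
exists 1 => _ [n _ <-].
suff H : ell_series R a n <= 1 - n.+1%:R / 2 ^+ n.
  apply: le_trans H _.
  by rewrite gerBl divr_ge0 ?ler0n ?exprn_ge0.
elim: n => [|n IH].
  by rewrite /ell_series /series /= big_geq // expr0 divr1 subrr.
rewrite /ell_series seriesSr.
have h : (ell a n)%:R / 2 ^+ n.+1 <= n%:R / 2 ^+ n.+1 :> R.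
  by rewrite ler_pM2r ?ler_nat ?ell_le // invr_gt0 exprn_gt0.
apply: le_trans (lerD IH h) _.
have -> : n.+1%:R / 2 ^+ n = (2 * n.+1%:R) / 2 ^+ n.+1 :> R.
  by rewrite exprS -mulf_div divff ?mul1r // pnatr_eq0.
rewrite -(natr1 n.+1) -(natr1 n); move: (2 ^+ n.+1)^-1 => z; lra.
Qed.

(* The digits N_k, N_(k-1), ..., N_0, 0, 0, ... of N < 2^(k+1). *)
Lemma frac_bit_dyadic (R : realType) (k N j : nat) :
  frac_bit (N%:R / 2 ^+ k.+1 : R) j = (j <= k)%N && nbit N (k - j).
Proof.
have E2 m : (2 ^+ m : R) != 0 by rewrite expf_neq0 // pnatr_eq0.
rewrite /frac_bit /nbit; case: leqP => [jk|kj] /=; last first.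
  have -> : 2 ^+ j.+1 * (N%:R / 2 ^+ k.+1) = (2 ^ (j - k) * N)%N%:R :> R.
    have -> : (2 ^+ j.+1 : R) = 2 ^+ (j - k) * 2 ^+ k.+1.
      by rewrite -exprD addnS subnK // ltnW.
    by rewrite natrM natrX -mulrA [2 ^+ k.+1 * _]mulrC divfK.
  by rewrite natrK oddM oddX subn_eq0 leqNgt kj.
congr odd; apply: truncn_def.
have -> : 2 ^+ j.+1 * (N%:R / 2 ^+ k.+1) = N%:R / 2 ^+ (k - j) :> R.
  have -> : (2 ^+ k.+1 : R) = 2 ^+ (k - j) * 2 ^+ j.+1.
    by rewrite -exprD addnS subnK.
  by rewrite invfM mulrA [X in X * _]mulrC -mulrA [X in _ * (_ * X)]mulrC mulVKf.
have p0 : 0 < (2 ^+ (k - j) : R) by rewrite exprn_gt0.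
rewrite ler_pdivlMr // ltr_pdivrMr // -natrX -!natrM ler_nat ltr_nat.
by rewrite leq_divM ltn_ceil // expn_gt0.
Qed.

Lemma takagi_dyadic (R : realType) (k N : nat) :
  takagi (N%:R / 2 ^+ k.+1 : R) =
  limn (ell_series R (fun j => (j <= k)%N && nbit N (k - j))).
Proof.
rewrite /takagi; set b := frac_bit _; set d := (X in _ = limn (ell_series _ X)).
suff -> : b = d by [].
by apply: funext => j; exact: frac_bit_dyadic.
Qed.

Lemma takagi1 (R : realType) : takagi (1 : R) = 0.
Proof.
have b0 n : frac_bit (1 : R) n = false.
  by rewrite /frac_bit mulr1 -natrX natrK oddX.
rewrite /takagi; have -> : ell_series R (frac_bit (1 : R)) = fun=> 0.
  apply/funext => n; rewrite /ell_series /series /= big1 // => i _.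
  by rewrite /ell b0 big1 ?mul0r // => j _; rewrite b0.
exact: lim_cst.
Qed.

(* Main.v *)
Require Import Defs.
From mathcomp Require Import all_boot all_order all_algebra.
From mathcomp Require Import all_classical all_reals all_analysis.
From mathcomp Require Import zify lra ring.

Import Order.TTheory GRing.Theory Num.Theory.
Import numFieldNormedType.Exports.
Local Open Scope ring_scope.

(** The Takagi function is self-similar: on each half of [0, 1] it is an affine
    function plus a copy of itself at half the height and half the width
    ([takagi_left], [takagi_right]).  In terms of digits, dropping the first
    digit of x lowers the i-th discrepancy count [ell] by one exactly when the
    first digit differs from the i-th ([ellS]).  Summing these corrections with
    their dyadic weights gives half of the binary expansion of the shifted
    number y or, if the first digit is 1, of its complement 1 - y.

    Self-similarity gives the case of an odd numerator r = 2m + 1, that is of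
    a midpoint of two neighbours m / 2^(k-1) and (m+1) / 2^(k-1)
    ([takagi_midpoint]).  The three points lie in the same half of [0, 1], where
    the affine part has no second difference, so doubling reduces the level
    by one and halves the defect, which is 1/2 for the whole interval [0, 1].

    A general numerator is handled by induction on the position rho of its
    lowest set bit ([takagi_second_difference]).  If r = 2m, then both
    neighbours (2m - 1) / 2^k and (2m + 1) / 2^k are midpoints at level k, and
    averaging their midpoint identities expresses their mean through the
    values at (m - 1), m and (m + 1) over 2^(k-1), where the lowest bit is
    rho - 1.  This contributes -(1 - (rho - 1)) / 2^k, the midpoint
    defects contribute 1 / 2^k, and the correction for r is therefore
    ((1 - (rho - 1)) - 1) / 2^k = (1 - rho) / 2^k. *)

(** * Shifting the digits *)

Definition binary_series (R : realType) (a : nat -> bool) : R ^nat :=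
  series (fun i : nat => (a i)%:R / 2 ^+ i.+1).

Lemma exp2_neq0 (R : realType) n : (2 ^+ n : R) != 0.
Proof. by rewrite expf_neq0 // pnatr_eq0. Qed.

Lemma ell_seriesSr (R : realType) (a : nat -> bool) (n : nat) :
  ell_series R a n.+1 = ell_series R a n + (ell a n)%:R / 2 ^+ n.+1.
Proof. exact: seriesSr. Qed.

Lemma binary_seriesSr (R : realType) (a : nat -> bool) (n : nat) :
  binary_series R a n.+1 = binary_series R a n + (a n)%:R / 2 ^+ n.+1.
Proof. exact: seriesSr. Qed.

(** [ell a i] counts the digits before position i that differ from [a i]; the
    first digit is counted separately from those of the shifted sequence. *)
Lemma ellS (a : nat -> bool) (i : nat) :
  ell a i.+1 = (ell (fun j => a j.+1) i + (a 0 (+) a i.+1))%N.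
Proof.
have : (\sum_(j < i) a j.+1 <= i)%N.
  rewrite -[leqRHS]card_ord -sum1_card; apply: leq_sum => j _.
  exact: leq_b1.
rewrite /ell big_ord_recl /=.
rewrite (eq_bigr (fun j : 'I_i => a j.+1 : nat)) //.
by case: (a 0); case: (a i.+1) => /=; lia.
Qed.

Lemma ell_seriesS (R : realType) (a : nat -> bool) (n : nat) :
  ell_series R a n.+1 =
    (ell_series R (fun j => a j.+1) n
     + binary_series R (fun j => a 0 (+) a j.+1) n) / 2.
Proof.
elim: n => [|n IH].
  rewrite /ell_series /binary_series seriesSr /series /= !big_geq //.
  by rewrite /ell big_ord0 subnn if_same !mul0r !addr0 mul0r.
rewrite ell_seriesSr IH (ell_seriesSr _ _ n) binary_seriesSr ellS natrD.
rewrite [2 ^+ n.+2]exprS.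
by field; rewrite exp2_neq0.
Qed.

(** A digit and its complement add up to 1, so the two partial sums add up to
    1/2 + ... + 1/2^n = 1 - 1/2^n. *)
Lemma binary_series_negb (R : realType) (a : nat -> bool) (n : nat) :
  binary_series R (fun j => ~~ a j) n = 1 - 2^-1 ^+ n - binary_series R a n.
Proof.
elim: n => [|n IH].
  by rewrite /binary_series /series /= !big_geq // expr0 subrr subr0.
rewrite !binary_seriesSr IH.
have -> : (~~ a n)%:R = 1 - (a n)%:R :> R by case: (a n) => /=; ring.
by rewrite -!exprVn exprS; field.
Qed.

(** Truncating the expansion after n digits is rounding down to a multiple of
    2^-n; this holds because floor (2 y) is 2 (floor y) plus its own parity. *)
Lemma binary_series_frac_bit (R : realType) (x : R) (n : nat) :
  0 <= x < 1 ->
  binary_series R (frac_bit x) n = (Num.truncn (2 ^+ n * x))%:R / 2 ^+ n.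
Proof.
move=> /andP[x0 x1]; elim: n => [|n IH].
  rewrite /binary_series /series /= big_geq // expr0 mul1r divr1.
  by rewrite (@truncn_def _ x 0) // x0.
rewrite binary_seriesSr IH.
rewrite /frac_bit; set m := Num.truncn _; set p := Num.truncn _.
(* The floor of 2^n x is the floor of 2^(n+1) x without its last digit. *)
have mE : m = p./2.
  apply: truncn_def.
  have y0 : 0 <= 2 ^+ n.+1 * x by rewrite mulr_ge0 ?exprn_ge0.
  have := truncn_itv y0; rewrite -/p exprS -mulrA => /andP[].
  move: (2 ^+ n * x) => y; rewrite -{1 2}(odd_double_half p).
  rewrite -[(_ + _).+1%:R]natr1 -[p./2.+1%:R]natr1 -mul2n natrD natrM.
  by case: (odd p); rewrite /= ?mulr0n ?mulr1n => h1 h2; apply/andP; split; lra.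
rewrite mE -{3}(odd_double_half p) -mul2n natrD natrM exprS.
by field; rewrite exp2_neq0.
Qed.

Lemma cvg_half_expr (R : realType) :
  (GRing.exp (2^-1 : R) @ \oo --> (0 : R))%classic.
Proof. by apply: cvg_expr; rewrite ger0_norm ?invr_ge0 // invf_lt1 ?ltr1n. Qed.

Lemma cvg_binary_series_frac_bit (R : realType) (x : R) :
  0 <= x < 1 -> (binary_series R (frac_bit x) @ \oo --> x)%classic.
Proof.
move=> x01.
apply: (@squeeze_cvgr _ _ _ _ (fun n => x - 2^-1 ^+ n) (fun=> x)).
- near=> n; rewrite binary_series_frac_bit // exprVn.
  have p0 : 0 < 2 ^+ n :> R by rewrite exprn_gt0.
  have y0 : 0 <= 2 ^+ n * x by case/andP: x01 => x0 _; rewrite mulr_ge0 // ltW.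
  have /andP[h1 h2] := truncn_itv y0.
  rewrite ler_pdivrMr // [x * _]mulrC h1 andbT ler_pdivlMr // mulrBl.
  by rewrite mulVf ?exp2_neq0 // lerBlDr natr1 mulrC ltW.
- rewrite -[X in (_ --> X)%classic]subr0.
  by apply: cvgB; [exact: cvg_cst | exact: cvg_half_expr].
- exact: cvg_cst.
Unshelve. all: by end_near. Qed.

(** * Self-similarity of the Takagi function *)

(** The common form of the two halves of the functional equation: y has the
    digits of x without the first one, and l is y or 1 - y according to that
    first digit. *)
Lemma takagi_rec (R : realType) (x y l : R) :
  frac_bit y = (fun j => frac_bit x j.+1) ->
  (binary_series R (fun j => frac_bit x 0 (+) frac_bit y j) @ \oo
     --> l)%classic ->
  takagi x = (l + takagi y) / 2.
Proof.
move=> yE cl; apply: cvg_lim; first exact: Rhausdorff.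
rewrite -cvg_shiftS.
have -> : [sequence ell_series R (frac_bit x) n.+1]_n =
  (fun n => (binary_series R (fun j => frac_bit x 0 (+) frac_bit y j) n
             + ell_series R (frac_bit y) n) / 2).
  by apply/funext => n; rewrite /= ell_seriesS yE addrC.
apply: cvgMl; apply: cvgD => //.
exact: is_cvg_ell_series.
Qed.

Lemma takagi_lt_half (R : realType) (x : R) :
  0 <= x < 1 / 2 -> takagi x = x + takagi (2 * x) / 2.
Proof.
move=> x01.
have bx0 : frac_bit x 0 = false.
  by rewrite /frac_bit (@truncn_def _ _ 0) // expr1; apply/andP; split; lra.
rewrite (@takagi_rec _ x (2 * x) (2 * x)).
- lra.
- by apply/funext => j; rewrite /frac_bit [2 ^+ j.+2]exprSr mulrA.
- rewrite bx0; apply: cvg_binary_series_frac_bit; apply/andP; split; lra.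
Qed.

Lemma takagi_ge_half (R : realType) (x : R) :
  1 / 2 <= x < 1 -> takagi x = 1 - x + takagi (2 * x - 1) / 2.
Proof.
move=> x01.
have bx0 : frac_bit x 0 = true.
  by rewrite /frac_bit (@truncn_def _ _ 1) // expr1; apply/andP; split; lra.
rewrite (@takagi_rec _ x (2 * x - 1) (1 - (2 * x - 1))).
- lra.
- apply/funext => j; rewrite /frac_bit.
  have -> : 2 ^+ j.+2 * x = (2 ^ j.+1)%N%:R + 2 ^+ j.+1 * (2 * x - 1).
    by rewrite natrX [2 ^+ j.+2]exprSr; ring.
  rewrite truncnD ?natr_nat //; last first.
    by rewrite nnegrE mulr_ge0 ?exprn_ge0 //; lra.
  by rewrite natrK oddD oddX.
- rewrite bx0 (_ : binary_series R _ =
    (fun n => 1 - 2^-1 ^+ n - binary_series R (frac_bit (2 * x - 1)) n)).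
    apply: cvgB; last first.
      by apply: cvg_binary_series_frac_bit; apply/andP; split; lra.
    rewrite -[X in (_ --> X)%classic]subr0.
    by apply: cvgB; [exact: cvg_cst | exact: cvg_half_expr].
  by apply/funext => n; rewrite -binary_series_negb.
Qed.

Lemma takagi0 (R : realType) : takagi (0 : R) = 0.
Proof. by have := @takagi_lt_half R 0; rewrite mulr0; lra. Qed.

(** The two halves overlap at 1/2, where both formulas hold since the function
    vanishes at 0 and at 1.  The closed intervals let the three points of
    [takagi_midpoint] share one formula. *)
Lemma takagi_left (R : realType) (x : R) :
  0 <= x <= 1 / 2 -> takagi x = x + takagi (2 * x) / 2.
Proof.
move=> /andP[x0]; rewrite le_eqVlt => /predU1P[->|x1]; last first.
  by apply: takagi_lt_half; rewrite x0.
rewrite takagi_ge_half; last by apply/andP; split; lra.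
have -> : 2 * (1 / 2) = 1 :> R by lra.
by rewrite subrr takagi0 takagi1; lra.
Qed.

Lemma takagi_right (R : realType) (x : R) :
  1 / 2 <= x <= 1 -> takagi x = 1 - x + takagi (2 * x - 1) / 2.
Proof.
move=> /andP[x0]; rewrite le_eqVlt => /predU1P[->|x1]; last first.
  by apply: takagi_ge_half; rewrite x0.
have -> : 2 * 1 - 1 = 1 :> R by lra.
by rewrite takagi1; lra.
Qed.

(** * Second differences at dyadic points *)

(** An interval [m / 2^k, (m+1) / 2^k] with k > 0 never crosses 1/2, so one of
    [takagi_left] and [takagi_right] applies to its endpoints and its midpoint
    and reduces k by one. *)
Lemma takagi_midpoint (R : realType) (k m : nat) :
  (m < 2 ^ k)%N ->
  takagi ((m%:R + 1 / 2) / 2 ^+ k : R) =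
    (takagi (m%:R / 2 ^+ k) + takagi ((m%:R + 1) / 2 ^+ k)) / 2
    + 1 / 2 ^+ k.+1.
Proof.
elim: k m => [|k IH] m mk.
  have -> : m = 0%N by move: mk; rewrite expn0; case: m.
  rewrite expr0 expr1 !divr1 !add0r takagi0 takagi1 takagi_left.
    have -> : 2 * (1 / 2) = 1 :> R by lra.
    by rewrite takagi1; lra.
  by apply/andP; split; lra.
have double z : 2 * (z / 2 ^+ k.+1) = z / 2 ^+ k :> R.
  by rewrite exprS; field; rewrite exp2_neq0.
have half : 2 ^+ k / 2 ^+ k.+1 = 1 / 2 :> R.
  by rewrite exprS; field; rewrite exp2_neq0.
have [mk'|mk'] := ltnP m (2 ^ k).
  have left z : 0 <= z <= 2 ^+ k ->
      takagi (z / 2 ^+ k.+1 : R) = z / 2 ^+ k.+1 + takagi (z / 2 ^+ k) / 2.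
    move=> /andP[z0 zk]; rewrite takagi_left ?double //.
    rewrite divr_ge0 ?exprn_ge0 //= -half.
    by rewrite ler_pM2r // invr_gt0 exprn_gt0.
  have mR0 : 0 <= m%:R :> R by exact: ler0n.
  have mR1 : m%:R + 1 <= 2 ^+ k :> R by rewrite natr1 -natrX ler_nat.
  (* The affine part x has midpoint defect 0. *)
  rewrite !left ?IH //; try by apply/andP; split; lra.
  rewrite [2 ^+ k.+2]exprS [2 ^+ k.+1]exprS.
  by field; rewrite exp2_neq0.
have right z : 2 ^+ k <= z <= 2 ^+ k.+1 -> takagi (z / 2 ^+ k.+1 : R) =
    1 - z / 2 ^+ k.+1 + takagi ((z - 2 ^+ k) / 2 ^+ k) / 2.
  move=> /andP[zk zk1]; rewrite takagi_right ?double.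
    by rewrite mulrBl divff ?exp2_neq0.
  rewrite -half ler_pM2r ?invr_gt0 ?exprn_gt0 // zk /=.
  by rewrite ler_pdivrMr ?exprn_gt0 // mul1r.
have mR0 : 2 ^+ k <= m%:R :> R by rewrite -natrX ler_nat.
have mR1 : m%:R + 1 <= 2 ^+ k.+1 :> R by rewrite natr1 -natrX ler_nat.
rewrite !right; try by apply/andP; split; lra.
have mB : m%:R - 2 ^+ k = (m - 2 ^ k)%N%:R :> R by rewrite natrB ?natrX.
have mk2 : (m - 2 ^ k < 2 ^ k)%N by rewrite ltn_subLR // addnn -mul2n -expnS.
rewrite !(addrAC m%:R _ (- 2 ^+ k)) mB IH //.
rewrite [2 ^+ k.+2]exprS [2 ^+ k.+1]exprS.
by field; rewrite exp2_neq0.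
Qed.

Lemma nbit0 (r : nat) : nbit r 0 = odd r.
Proof. by rewrite /nbit expn0 divn1. Qed.

Lemma nbitS (r i : nat) : nbit r i.+1 = nbit r./2 i.
Proof. by rewrite /nbit expnS divnMA divn2. Qed.

(** A numerator r > 0 is 2m + 1 or 2m, and in the second case the lowest set bit
    of m is one position lower: the even case at level k + 1 combines the
    midpoint identities on both sides of m / 2^k with the second difference at
    m / 2^k. *)
Lemma takagi_second_difference (R : realType) (rho k r : nat) :
  (0 < r < 2 ^ k)%N -> lowest_set_bit r rho ->
  takagi (r%:R / 2 ^+ k : R) =
    1 / 2 * (takagi ((r%:R - 1) / 2 ^+ k) + takagi ((r%:R + 1) / 2 ^+ k))
    + (1 - rho%:R) / 2 ^+ k.
Proof.
elim: rho k r => [|rho IH] [|k] r /andP[r0 rk] [brho blow]; try by lia.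
  move: brho; rewrite nbit0 => r1.
  have rE : r = (r./2.*2).+1 by rewrite -[LHS]odd_double_half r1.
  have hk : (r./2 < 2 ^ k)%N by move: rk; rewrite expnS; lia.
  have := @takagi_midpoint R k _ hk; move: r./2 rE => m -> mid.
  rewrite -natr1 -mul2n natrM.
  have -> : (2 * m%:R + 1) / 2 ^+ k.+1 = (m%:R + 1 / 2) / 2 ^+ k :> R.
    by rewrite exprS; field; rewrite exp2_neq0.
  have -> : (2 * m%:R + 1 - 1) / 2 ^+ k.+1 = m%:R / 2 ^+ k :> R.
    by rewrite exprS; field; rewrite exp2_neq0.
  have -> : (2 * m%:R + 1 + 1) / 2 ^+ k.+1 = (m%:R + 1) / 2 ^+ k :> R.
    by rewrite exprS; field; rewrite exp2_neq0.
  by rewrite mid subr0; lra.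
have r1 : ~~ odd r by rewrite -nbit0; apply: blow.
have [m rE] : exists m, r = m.*2.
  by exists r./2; rewrite -[LHS]odd_double_half (negbTE r1).
have mhalf : m = r./2 by rewrite rE doubleK.
have m0 : (0 < m)%N by lia.
have mk : (m < 2 ^ k)%N by move: rk; rewrite expnS; lia.
have low : lowest_set_bit m rho.
  by rewrite mhalf; split=> [|j jrho]; rewrite -nbitS // blow.
have {IH} := IH k m; rewrite m0 mk => /(_ isT low).
(* The two neighbours of 2m / 2^(k+1) are the midpoints of the intervals that
   end and begin at m / 2^k. *)
have := @takagi_midpoint R k _ (leq_ltn_trans (leq_pred _) mk).
have := @takagi_midpoint R k _ mk.
have -> : m.-1%:R = m%:R - 1 :> R by rewrite -subn1 natrB.
rewrite subrK rE -mul2n natrM -[rho.+1%:R]natr1.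
have -> : (2 * m%:R) / 2 ^+ k.+1 = m%:R / 2 ^+ k :> R.
  by rewrite exprS; field; rewrite exp2_neq0.
have -> : (2 * m%:R - 1) / 2 ^+ k.+1 = (m%:R - 1 + 1 / 2) / 2 ^+ k :> R.
  by rewrite exprS; field; rewrite exp2_neq0.
have -> : (2 * m%:R + 1) / 2 ^+ k.+1 = (m%:R + 1 / 2) / 2 ^+ k :> R.
  by rewrite exprS; field; rewrite exp2_neq0.
move=> -> -> secm.
suff -> : (1 - (rho%:R + 1)) / 2 ^+ k.+1 =
    (1 - rho%:R) / 2 ^+ k / 2 - 1 / 2 ^+ k.+1 :> R by lra.
by rewrite exprS; field; rewrite exp2_neq0.
Qed.

Theorem theorem24 (R : realType) (k r rho1 : nat)
    (hk : (1 <= k)%N) (hr1 : (1 <= r)%N) (hr2 : (r <= 2 ^ k - 1)%N)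
    (hrho1 : lowest_set_bit r rho1) :
  takagi (r%:R / 2 ^+ k : R) =
    1 / 2 * (takagi ((r%:R - 1) / 2 ^+ k) + takagi ((r%:R + 1) / 2 ^+ k))
    + (1 - rho1%:R) / 2 ^+ k.
Proof.
apply: takagi_second_difference => //.
by rewrite hr1 /= (leq_ltn_trans hr2) // subn1 prednK ?expn_gt0.
Qed.
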